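(* Let $k\ge 2$ be an integer. If $a_{\min}$ is the minimum element of a positive Collatz cycle of length $k$, then $a_{\min}<k(3^k+1)/4<k3^{k-1}$.
   Context: Let $\mathbb{Z}_{odd}:=\mathbb{Z}\setminus 2\mathbb{Z}$ be the set of odd integers. Define $f:\mathbb{Z}_{odd}\to\mathbb{Z}_{odd}$ by $f(a):=(3a+1)/2^n$, where $n$ is the exponent of the largest power of $2$ dividing $3a+1$. For $a\in\mathbb{Z}_{odd}$, if $k$ is the minimum positive integer with $f^k(a)=a$, the sequence $(f^i(a))_{i=0}^{k-1}$ is called the Collatz cycle starting with $a$, and $k$ is its length. A Collatz cycle is positive if its initial term (hence every term) is a positive integer. *)

(* Defs.v *)
From HB Require Import structures.
From mathcomp Require Import all_boot all_order all_algebra.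

Set Implicit Arguments.
Unset Strict Implicit.
Unset Printing Implicit Defensive.

Import Order.TTheory GRing.Theory Num.Theory.
Local Open Scope ring_scope.

Record Zodd : Type := MkZodd { Zodd_val :> int; _ : ~~ (2 %| Zodd_val)%Z }.

HB.instance Definition _ := [isSub for Zodd_val].
HB.instance Definition _ := [Choice of Zodd by <:].

Definition val2 (m : int) : nat := logn 2 `|m|%N.

Lemma three_mul_add1_neq0 (a : int) : 3 * a + 1 != 0.
Proof.
apply/negP => /eqP h.
have : (3 %| - (3 * a) + 0)%Z by rewrite addr0 dvdzE abszN -dvdzE dvdz_mulr.
by rewrite -h addrA addNr add0r.
Qed.

Lemma odd_part_odd (m : int) :
  m != 0 -> ~~ (2 %| m %/ 2 ^+ val2 m)%Z.
Proof.
move=> m0; have mgt0 : (0 < `|m|)%N by rewrite absz_gt0.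
have hd : (2 ^+ val2 m %| m)%Z by rewrite dvdzE abszX pfactor_dvdnn.
apply/negP => /(dvdz_mul (dvdzz (2 ^+ val2 m))).
rewrite [X in (_ %| X)%Z]mulrC (divzK hd) -exprSr dvdzE abszX.
by rewrite pfactor_dvdn // ltnn.
Qed.

(* The division is exact, and [3 * a + 1] is never 0, so that [val2] is the
   genuine 2-adic valuation here. *)
Definition collatz (a : Zodd) : Zodd :=
  MkZodd (odd_part_odd (three_mul_add1_neq0 a)).

Definition is_min_period (a : Zodd) (k : nat) : Prop :=
  [/\ (0 < k)%N, iter k collatz a = a
    & forall j : nat, (0 < j)%N -> iter j collatz a = a -> (k <= j)%N].

(* [traject collatz a k] is the sequence of the [iter i collatz a], [i < k];
   the length of the cycle [s] is [size s]. *)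
Definition collatz_cycle_from (a : Zodd) (s : seq Zodd) : Prop :=
  exists2 k : nat, is_min_period a k & s = traject collatz a k.

Definition positive_collatz_cycle (s : seq Zodd) : Prop :=
  exists a : Zodd, collatz_cycle_from a s /\ 0 < (a : int).

Definition is_min_of (s : seq Zodd) (m : Zodd) : Prop :=
  m \in s /\ forall x : Zodd, x \in s -> (m : int) <= (x : int).

Lemma collatzE (a : Zodd) :
  (collatz a : int) = ((3 * (a : int) + 1) %/ 2 ^+ val2 (3 * (a : int) + 1))%Z.
Proof. by []. Qed.

(* Main.v *)
(* Multiplying the relations [2^e_i * a_(i+1) = 3 a_i + 1] around a cycle with
   minimum [m] gives [3^k < 2^N] and [2^N m^k <= (3m + 1)^k], where [N] is the
   sum of the [e_i].  Since [3^k] is 1 or 3 modulo 8 and 8 divides [2^N], the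
   first inequality improves to [3^k + 5 <= 2^N].  Bernoulli's inequality then
   yields [5 (3m + 1) <= k (3^k + 5)], which is stronger than the claim. *)
Require Import Defs.
From mathcomp Require Import all_boot all_order all_algebra.
From mathcomp Require Import zify lra.

Import Order.TTheory GRing.Theory Num.Theory.
Local Open Scope ring_scope.

Section CycleOfNaturals.
Local Open Scope nat_scope.

Lemma expn3_mod8 k : 3 ^ k %% 8 = 1 \/ 3 ^ k %% 8 = 3.
Proof. by elim: k => [|k IH]; [left | rewrite expnS; lia]. Qed.

Lemma expn3_expn2_gap k N : 2 <= k -> 3 ^ k <= 2 ^ N -> 3 ^ k + 5 <= 2 ^ N.
Proof.
move=> k2 le32; have le9 : 3 ^ 2 <= 3 ^ k by rewrite leq_exp2l.
(* Since [2 ^ N] is at least 9, it is divisible by 8, so [2 ^ N - 3 ^ k] is 7 or 5 modulo 8. *)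
have N3 : 3 <= N.
  by rewrite leqNgt; apply/negP => N2; have := @leq_pexp2l 2 N 2 isT N2; lia.
move: le32; rewrite -(subnKC N3) expnD; have := expn3_mod8 k; lia.
Qed.

(* [(1 - 1/(n+1))^k >= 1 - k/(n+1)] with denominators cleared. *)
Lemma bernoulli_nat n k : n.+1 ^ k * n.+1 <= n ^ k * n.+1 + k * n.+1 ^ k.
Proof.
elim: k => [|k IH]; first by rewrite !expn0; lia.
rewrite !expnS; nia.
Qed.

(** Put A = [3 ^ k]. Bernoulli with [n = 3 * m] bounds [(3 * m + 1) ^ k] from above, the gap bounds
    it from below by [(A + 5) * m ^ k]; cancelling [m ^ k] leaves [(A + 5) * (3 * m + 1 - k) <= A *
    (3 * m + 1)]. *)
Lemma expn_lin_bound k m N : 0 < m -> 2 <= k -> 3 ^ k <= 2 ^ N ->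
  2 ^ N * m ^ k <= (3 * m + 1) ^ k -> 5 * (3 * m + 1) <= k * (3 ^ k + 5).
Proof.
move=> m0 k2 /(expn3_expn2_gap _ _ k2) gap ub.
have := bernoulli_nat (3 * m) k; rewrite -addn1 expnMn.
have mk0 : 0 < m ^ k by rewrite expn_gt0 m0.
have {gap ub} : (3 ^ k + 5) * m ^ k <= (3 * m + 1) ^ k.
  by apply: leq_trans ub; rewrite leq_mul2r gap orbT.
move: (3 ^ k) (m ^ k) ((3 * m + 1) ^ k) mk0 => A M B mk0 lb bern.
(* If [3 * m + 1 <= k], the goal follows from [5 * k <= k * (A + 5)]; otherwise the subtraction
   below is not truncated. *)
have [lek|ltk] := leqP (3 * m + 1) k; first by nia.
have {}bern : B * (3 * m + 1 - k) <= A * M * (3 * m + 1).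
  by rewrite mulnBr; lia.
have : M * ((A + 5) * (3 * m + 1 - k)) <= M * (A * (3 * m + 1)).
  apply: leq_trans (_ : B * (3 * m + 1 - k) <= _); last by lia.
  by rewrite mulnA (mulnC M) leq_mul2r lb orbT.
rewrite leq_pmul2l // mulnBr; lia.
Qed.

Lemma collatz_cycle_min_bound k (x e : nat -> nat) m :
    2 <= k -> 0 < m -> x k = x 0 ->
    (forall i, x i.+1 * 2 ^ e i = 3 * x i + 1) ->
    (forall i, i < k -> m <= x i) ->
  5 * (3 * m + 1) <= k * (3 ^ k + 5).
Proof.
move=> k2 m0 xk rec lemx; pose X := \prod_(i < k) x i.
pose N := \sum_(i < k) e i.
have X0 : 0 < X by rewrite prodn_gt0 // => i; apply: leq_trans (lemx i _).
have prodE : X * 2 ^ N = \prod_(i < k) (3 * x i + 1).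
  (* As [x k = x 0], shifting the index only permutes the factors cyclically. *)
  have -> : X = \prod_(i < k) x i.+1.
    rewrite /X; case: k k2 xk {lemx X N X0} => // k _ xk.
    by rewrite big_ord_recl big_ord_recr /= xk mulnC.
  rewrite /N expn_sum -big_split /=.
  by apply: eq_bigr => i _; apply: rec.
apply: (@expn_lin_bound k m N) => //.
  rewrite -(leq_pmul2l X0) prodE mulnC -[k in 3 ^ k]card_ord -prod_nat_const.
  by rewrite -big_split /=; apply: leq_prod => i _; lia.
(* Factor by factor, [(3 * x i + 1) * m <= x i * (3 * m + 1)], which amounts to [m <= x i]. *)
rewrite -(leq_pmul2l X0) mulnA prodE.
rewrite -[k in m ^ k]card_ord -[k in (3 * m + 1) ^ k]card_ord -!prod_nat_const.
rewrite -!big_split /=; apply: leq_prod => i _; have := lemx i (ltn_ord i); nia.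
Qed.

End CycleOfNaturals.

Lemma collatz_mul_pow2 (a : Zodd) :
  (collatz a : int) * 2 ^+ val2 (3 * (a : int) + 1) = 3 * (a : int) + 1.
Proof.
rewrite collatzE divzK // dvdzE abszX pfactor_dvdn //.
by rewrite absz_gt0 three_mul_add1_neq0.
Qed.

Lemma collatz_gt0 (a : Zodd) : 0 < (a : int) -> 0 < (collatz a : int).
Proof.
move=> a0; have p0 : 0 < 2 ^+ val2 (3 * (a : int) + 1) :> int.
  exact: exprn_gt0.
by rewrite -(pmulr_lgt0 _ p0) collatz_mul_pow2; lia.
Qed.

Lemma iter_collatz_gt0 (a : Zodd) i :
  0 < (a : int) -> 0 < (iter i collatz a : int).
Proof. by move=> a0; elim: i => //= i; apply: collatz_gt0. Qed.

Lemma absz_collatz_mul_pow2 (a : Zodd) : 0 < (a : int) ->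
  (`|(collatz a : int)| * 2 ^ val2 (3 * (a : int) + 1) = 3 * `|(a : int)| + 1)%N.
Proof.
move=> a0; have -> : (3 * `|(a : int)| + 1 = `|(3 * (a : int) + 1)%R|)%N by lia.
by rewrite -[in RHS]collatz_mul_pow2 abszM abszX.
Qed.

Theorem theorem1 (k : nat) (hk : (2 <= k)%N) (s : seq Zodd) (amin : Zodd)
    (hs : positive_collatz_cycle s) (hsize : size s = k)
    (hmin : is_min_of s amin) :
  ((amin : int)%:~R < k%:R * (3 ^+ k + 1) / 4 :> rat) /\
  (k%:R * (3 ^+ k + 1) / 4 < k%:R * 3 ^+ (k - 1) :> rat).
Proof.
have k0 : 0 < k%:R :> rat by rewrite ltr0n; lia.
split; last first.
  have p3 : 3%:R <= 3 ^+ (k - 1) :> rat.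
    by rewrite -natrX ler_nat (@leq_exp2l 3 1) //; lia.
  have -> : 3 ^+ k = 3 * 3 ^+ (k - 1) :> rat.
    by rewrite -exprS; congr (_ ^+ _); lia.
  by nra.
case: hs => a [[k' [_ per _] sE] a0]; move: hsize hmin.
rewrite {s}sE size_traject => ?; subst k' => -[/trajectP[j jk ->] min_j].
set m := iter j collatz a; have m0 : 0 < (m : int) by apply: iter_collatz_gt0.
(* All terms are positive, so absolute values carry the cycle faithfully to the naturals. *)
have bound : (5 * (3 * `|(m : int)| + 1) <= k * (3 ^ k + 5))%N.
  apply: (@collatz_cycle_min_bound k (fun i => `|(iter i collatz a : int)|%N)
    (fun i => val2 (3 * (iter i collatz a : int) + 1))) => //.
  - by lia.
  - by rewrite per.
  - by move=> i; rewrite absz_collatz_mul_pow2 //; apply: iter_collatz_gt0.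
  - move=> i ik; have : (m : int) <= (iter i collatz a : int).
      by apply: min_j; apply/trajectP; exists i.
    by have := iter_collatz_gt0 a i a0; lia.
have -> : (m : int)%:~R = `|(m : int)|%N%:R :> rat.
  by rewrite natr_absz gtr0_norm.
move: bound; rewrite -(ler_nat rat) !(natrM, natrD, natrX) => bound.
(* With A = [3 ^+ k], it remains to compare [4 * (A + 5)] with [15 * (A + 1)], that is, 5 with
   [11 * A]. *)
have p3 : 9%:R <= 3 ^+ k :> rat by rewrite -natrX ler_nat (@leq_exp2l 3 2).
by nra.
Qed.
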